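(* Let $\mathbb{K}\in\{\mathbb{K}_c,\mathbb{K}_v,\mathbb{K}_o,\mathbb{K}_s,\mathbb{K}_d\}$, let $f,F_{1,i},F_{2,i}:\mathbb{R}^n\to\mathbb{R}$, $i=1,\ldots,m$, be twice continuously differentiable, let $M=\{x\in\mathbb{R}^n \mid (F_{1,i}(x),F_{2,i}(x))\in\mathbb{K},\ i=1,\ldots,m\}$, and let $\bar x\in M$ satisfy SNO-LICQ and $F_{1,i}(\bar x)=F_{2,i}(\bar x)=0$ for all $i=1,\ldots,m$. Suppose that $\bar x$ is a T-stationary point of the problem $\min_x f(x)$ s.t. $x\in M$. Then $\bar x$ is not $N$-stationary if and only if $\bar x$ is a regular saddle point of first order.
   Context: Cones in $\mathbb{R}^2$: $\mathbb{K}_c=\{(a_1,a_2)\mid a_1a_2=0,\ a_1\ge 0,\ a_2\ge 0\}$ (complementarity, MPCC); $\mathbb{K}_v=\{(a_1,a_2)\mid a_1\ge 0,\ a_1a_2\le 0\}$ (vanishing, MPVC); $\mathbb{K}_o=\{(a_1,a_2)\mid a_1a_2=0,\ a_2\ge 0\}$ (orthogonality type, MPOC); $\mathbb{K}_s=\{(a_1,a_2)\mid a_1a_2=0\}$ (switching, MPSC); $\mathbb{K}_d=\{(a_1,a_2)\mid a_1\ge 0\text{ or }a_2\ge 0\}$ (disjunctive, MPDC). The structured nonsmooth optimization problem SNO is: minimize $f(x)$ subject to $x\in M$. SNO-LICQ at $\bar x\in M$: the vectors $\nabla F_{1,i}(\bar x)$ for $i\in\{1,\ldots,m\}$ with $F_{1,i}(\bar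 x)=0$, together with $\nabla F_{2,i}(\bar x)$ for $i\in\{1,\ldots,m\}$ with $F_{2,i}(\bar x)=0$, are linearly independent. Biactive index set: $I_{00}(\bar x)=\{i\in\{1,\ldots,m\}\mid F_{1,i}(\bar x)=0,\ F_{2,i}(\bar x)=0\}$; it is assumed throughout that $I_{00}(\bar x)=\{1,\ldots,m\}$. The tangential cone $T_M(\bar x)$ consists of all $w$ for which there exist $x^k\to\bar x$ with $x^k\in M$ and $\tau^k\searrow 0$ such that $(x^k-\bar x)/\tau^k\to w$. The Fréchet normal cone is $\widehat N_M(\bar x)=\{v\mid \langle v,w\rangle\le 0\text{ for all }w\in T_M(\bar x)\}$. The Mordukhovich (limiting) normal cone $N_M(\bar x)$ consists of all $v$ for which there exist $x^k\to\bar x$ with $x^k\in M$ and $v^k\in\widehat N_M(x^k)$ with $v^k\to v$. The point $\bar x\in M$ is called $N$-stationary if $0\in\nabla f(\bar x)+N_M(\bar x)$. The point $\bar x\in M$ is called T-stationary if there are multipliers $\lambda_{1,i},\lambda_{2,i}\in\mathbb{R}$, $i\in I_{00}(\bar x)$ (unique under SNO-LICQ), with $$\nabla f(\bar x)=\sum_{i\in I_{00}(\bar x)}\bigl(\lambda_{1,i}\nabla F_{1,i}(\bar x)+\lambda_{2,i}\nabla F_{2,i}(\bar x)\bigr)$$ such that for all $i\in I_{00}(\bar x)$: if $\mathbb{K}=\mathbb{K}_c$: $\lambda_{1,i}\lambda_{2,i}\ge 0$; if $\mathbb{K}=\mathbb{K}_v$: $\lambda_{1,i}\lambda_{2,i}\ge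 0$ and $\lambda_{2,i}\le 0$; if $\mathbb{K}=\mathbb{K}_o$: $\lambda_{1,i}=0$ or $\lambda_{2,i}\le 0$; if $\mathbb{K}=\mathbb{K}_s$: no restriction; if $\mathbb{K}=\mathbb{K}_d$: $\lambda_{1,i}\ge 0$ and $\lambda_{2,i}\ge 0$. A T-stationary point $\bar x\in M$ with multipliers $\lambda_{1,i},\lambda_{2,i}$ is called a saddle point of first order if for some $i\in I_{00}(\bar x)$ one has $(\lambda_{1,i},\lambda_{2,i})\ne(0,0)$ and, in addition: if $\mathbb{K}=\mathbb{K}_c$: $\lambda_{1,i}\le 0$ and $\lambda_{2,i}\le 0$; if $\mathbb{K}=\mathbb{K}_v$: $\lambda_{1,i}\le 0$ and $\lambda_{2,i}\le 0$; if $\mathbb{K}=\mathbb{K}_o$: $\lambda_{2,i}\le 0$; if $\mathbb{K}=\mathbb{K}_s$: no further restriction; if $\mathbb{K}=\mathbb{K}_d$: $\lambda_{1,i}\ge 0$ and $\lambda_{2,i}\ge 0$. A saddle point of first order $\bar x$ with multipliers $\lambda_{1,i},\lambda_{2,i}$, $i\in I_{00}(\bar x)$, is called regular if there exists $i\in I_{00}(\bar x)$ with both $\lambda_{1,i}\ne 0$ and $\lambda_{2,i}\ne 0$.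
   Formalization: ''Regular'' here requires the index with both multipliers nonzero to also satisfy the saddle-point sign conditions; with unrelated indices the claim fails for K_c (f=-x1+x3+x4, F's the coordinates of R^4, x̄=0). For the other four cones nothing changes. *)

(* Defs.v *)
From HB Require Import structures.
From mathcomp Require Import all_boot all_order all_algebra.
From mathcomp Require Import all_classical all_reals all_analysis.

Set Implicit Arguments.
Unset Strict Implicit.
Unset Printing Implicit Defensive.

Import Order.TTheory GRing.Theory Num.Theory.
Import numFieldNormedType.Exports.

Local Open Scope classical_set_scope.
Local Open Scope ring_scope.

Definition inner_product (R : realType) (n : nat) (v w : 'rV[R]_n) : R :=
  \sum_(j < n) v 0 j * w 0 j.

Definition grad (R : realType) (n : nat) (f : 'rV[R]_n -> R) (x : 'rV[R]_n) :
    'rV[R]_n :=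
  \row_j 'D_(delta_mx 0 j) f x.

Definition continuously_differentiable (R : realType) (n : nat)
    (f : 'rV[R]_n -> R) : Prop :=
  (forall x, differentiable f x) /\ continuous (grad f).

Definition twice_continuously_differentiable (R : realType) (n : nat)
    (f : 'rV[R]_n -> R) : Prop :=
  continuously_differentiable f /\
  forall j : 'I_n, continuously_differentiable (fun x => grad f x 0 j).

Inductive cone_type : Type :=
  | Complementarity
  | Vanishing
  | Orthogonality
  | Switching
  | Disjunctive.

Definition cone (R : realType) (K : cone_type) : set (R * R) :=
  match K with
  | Complementarity => [set a | [/\ a.1 * a.2 = 0, 0 <= a.1 & 0 <= a.2]]
  | Vanishing => [set a | 0 <= a.1 /\ a.1 * a.2 <= 0]
  | Orthogonality => [set a | a.1 * a.2 = 0 /\ 0 <= a.2]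
  | Switching => [set a | a.1 * a.2 = 0]
  | Disjunctive => [set a | 0 <= a.1 \/ 0 <= a.2]
  end.

Definition feasible_set (R : realType) (n m : nat) (K : cone_type)
    (F1 F2 : 'I_m -> 'rV[R]_n -> R) : set 'rV[R]_n :=
  [set x | forall i : 'I_m, cone K (F1 i x, F2 i x)].

(* [free] is applied to a family with repetitions: the same vector occurring
   for two different constraints violates the condition. *)
Definition SNO_LICQ (R : realType) (n m : nat)
    (F1 F2 : 'I_m -> 'rV[R]_n -> R) (x : 'rV[R]_n) : Prop :=
  free ([seq grad (F1 i) x | i <- enum 'I_m & F1 i x == 0] ++
        [seq grad (F2 i) x | i <- enum 'I_m & F2 i x == 0]).

Definition biactive (R : realType) (n m : nat)
    (F1 F2 : 'I_m -> 'rV[R]_n -> R) (x : 'rV[R]_n) : {set 'I_m} :=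
  [set i : 'I_m | (F1 i x == 0) && (F2 i x == 0)]%SET.

Definition tangential_cone (R : realType) (n : nat) (M : set 'rV[R]_n)
    (xbar : 'rV[R]_n) : set 'rV[R]_n :=
  [set w | exists (x : nat -> 'rV[R]_n) (tau : nat -> R),
    [/\ forall k, M (x k),
        x k @[k --> \oo] --> xbar,
        forall k, 0 < tau k,
        tau k @[k --> \oo] --> (0 : R) &
        (tau k)^-1 *: (x k - xbar) @[k --> \oo] --> w]].

Definition frechet_normal_cone (R : realType) (n : nat) (M : set 'rV[R]_n)
    (xbar : 'rV[R]_n) : set 'rV[R]_n :=
  [set v | forall w, tangential_cone M xbar w -> inner_product v w <= 0].

Definition limiting_normal_cone (R : realType) (n : nat) (M : set 'rV[R]_n)
    (xbar : 'rV[R]_n) : set 'rV[R]_n :=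
  [set v | exists x v_ : nat -> 'rV[R]_n,
    [/\ forall k, M (x k),
        x k @[k --> \oo] --> xbar,
        forall k, frechet_normal_cone M (x k) (v_ k) &
        v_ k @[k --> \oo] --> v]].

Definition N_stationary (R : realType) (n : nat) (f : 'rV[R]_n -> R)
    (M : set 'rV[R]_n) (xbar : 'rV[R]_n) : Prop :=
  M xbar /\ exists2 v, limiting_normal_cone M xbar v & 0 = grad f xbar + v.

Definition T_condition (R : realType) (K : cone_type) (l1 l2 : R) : Prop :=
  match K with
  | Complementarity => 0 <= l1 * l2
  | Vanishing => 0 <= l1 * l2 /\ l2 <= 0
  | Orthogonality => l1 = 0 \/ l2 <= 0
  | Switching => True
  | Disjunctive => 0 <= l1 /\ 0 <= l2
  end.

(* The values of [lambda1] and [lambda2] outside the biactive set are never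
   used, here and below. *)
Definition T_stationary_with (R : realType) (n m : nat) (K : cone_type)
    (f : 'rV[R]_n -> R) (F1 F2 : 'I_m -> 'rV[R]_n -> R) (xbar : 'rV[R]_n)
    (lambda1 lambda2 : 'I_m -> R) : Prop :=
  [/\ feasible_set K F1 F2 xbar,
      grad f xbar =
        \sum_(i in biactive F1 F2 xbar)
          (lambda1 i *: grad (F1 i) xbar + lambda2 i *: grad (F2 i) xbar) &
      forall i, i \in biactive F1 F2 xbar ->
        T_condition K (lambda1 i) (lambda2 i)].

Definition T_stationary (R : realType) (n m : nat) (K : cone_type)
    (f : 'rV[R]_n -> R) (F1 F2 : 'I_m -> 'rV[R]_n -> R) (xbar : 'rV[R]_n) :
    Prop :=
  exists lambda1 lambda2 : 'I_m -> R,
    T_stationary_with K f F1 F2 xbar lambda1 lambda2.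

Definition saddle_condition (R : realType) (K : cone_type) (l1 l2 : R) : Prop :=
  (l1, l2) <> (0, 0) /\
  match K with
  | Complementarity => l1 <= 0 /\ l2 <= 0
  | Vanishing => l1 <= 0 /\ l2 <= 0
  | Orthogonality => l2 <= 0
  | Switching => True
  | Disjunctive => 0 <= l1 /\ 0 <= l2
  end.

Definition saddle_point_with (R : realType) (n m : nat) (K : cone_type)
    (f : 'rV[R]_n -> R) (F1 F2 : 'I_m -> 'rV[R]_n -> R) (xbar : 'rV[R]_n)
    (lambda1 lambda2 : 'I_m -> R) : Prop :=
  T_stationary_with K f F1 F2 xbar lambda1 lambda2 /\
  exists2 i, i \in biactive F1 F2 xbar &
    saddle_condition K (lambda1 i) (lambda2 i).

(* The index with two nonzero multipliers has to be one of those that make the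
   point a saddle point.  For complementarity constraints this matters: the
   multiplier pairs (-1, 0) and (1, 1) at two different indices must not count
   as regular. *)
Definition regular_saddle_point (R : realType) (n m : nat) (K : cone_type)
    (f : 'rV[R]_n -> R) (F1 F2 : 'I_m -> 'rV[R]_n -> R) (xbar : 'rV[R]_n) :
    Prop :=
  exists lambda1 lambda2 : 'I_m -> R,
    saddle_point_with K f F1 F2 xbar lambda1 lambda2 /\
    exists i, [/\ i \in biactive F1 F2 xbar,
                  saddle_condition K (lambda1 i) (lambda2 i),
                  lambda1 i <> 0 & lambda2 i <> 0].

(* Main.v *)
Require Import Defs.
From HB Require Import structures.
From mathcomp Require Import all_boot all_order all_algebra.
From mathcomp Require Import all_classical all_reals all_analysis.
From mathcomp Require Import ring lra.

(** Near [xbar] the [2m] constraint functions [F1 i, F2 i] can be used as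
    independent coordinates: their gradients at [xbar] have a dual family of
    directions, the rows of a matrix [W], and by Banach's fixed point theorem
    every small change [e] of the constraint values is realised exactly by a
    displacement close to [e *m W] ([local_lifting]).  In these coordinates
    the feasible set is locally a power of the planar cone [K] times a linear
    space, so everything is decided by the position, for each index [i], of the
    pair [(l1 i, l2 i)] with respect to [K].  Note that [- grad f xbar] is the combination of the constraint
    gradients with coefficients [- l1 i], [- l2 i].

    If no index is regular, every pair [(l1, l2)] admits a ray of [K] along which
    the linear form [l1 a1 + l2 a2] vanishes and locally attains its minimum over
    [K] ([nonregular_cone_ray]); for complementarity with both multipliers
    positive the ray degenerates to the origin.  Lifting small points of these
    rays gives feasible points tending to [xbar] at which
    [sum_i (l1 i F1 i + l2 i F2 i)] has a local minimum over the feasible set, so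
    that minus its gradient is a Frechet normal ([frechet_normal_of_local_min]).
    These normals tend to [- grad f xbar], which is thus a limiting normal.

    Conversely, at a regular index every point of [K] can travel inside [K]
    either along [(- l1, 0)] or along [(0, - l2)] ([cone_escape_direction]).
    So at each feasible point near [xbar] there is a tangent close to
    [- l1 *: w1] or to [- l2 *: w2], where [w1, w2] are the dual directions of
    [F1 i, F2 i] ([approximate_tangent]).  The inner product of [- grad f xbar]
    with these two directions is [l1 ^+ 2], respectively [l2 ^+ 2], hence
    positive, and stays positive for nearby vectors: Frechet normals at nearby
    points cannot tend to [- grad f xbar]. *)

Import Order.TTheory GRing.Theory Num.Theory.
Import numFieldNormedType.Exports.

Local Open Scope classical_set_scope.
Local Open Scope ring_scope.

(** * The standard inner product *)

Section InnerProduct.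
Context {R : realType} {n : nat}.
Implicit Types u v w : 'rV[R]_n.

Lemma inner_productC v w : inner_product v w = inner_product w v.
Proof. by apply: eq_bigr => j _; rewrite mulrC. Qed.

Lemma inner_productDr u v w :
  inner_product u (v + w) = inner_product u v + inner_product u w.
Proof. by rewrite -big_split; apply: eq_bigr => j _; rewrite mxE mulrDr. Qed.

Lemma inner_productZr a v w : inner_product v (a *: w) = a * inner_product v w.
Proof. by rewrite mulr_sumr; apply: eq_bigr => j _; rewrite mxE mulrCA. Qed.

Lemma inner_productNr v w : inner_product v (- w) = - inner_product v w.
Proof. by rewrite -scaleN1r inner_productZr mulN1r. Qed.

Lemma inner_product_sumr (I : finType) v (w : I -> 'rV[R]_n) :
  inner_product v (\sum_i w i) = \sum_i inner_product v (w i).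
Proof.
rewrite [RHS]exchange_big; apply: eq_bigr => j _.
by rewrite summxE mulr_sumr.
Qed.

Lemma inner_product_continuous {T : Type} {F : set_system T} {FF : Filter F}
    (p q : T -> 'rV[R]_n) v w :
  p @ F --> v -> q @ F --> w ->
  inner_product (p t) (q t) @[t --> F] --> inner_product v w.
Proof.
move=> pv qw; apply: (cvg_big (@add_continuous R)) => j _.
have coord (s : T -> 'rV[R]_n) u : s @ F --> u -> s t 0 j @[t --> F] --> u 0 j.
  move=> su; apply: (@cvg_comp _ _ _ s (fun u : 'rV[R]_n => u 0 j) _ _ _ su).
  exact: coord_continuous.
by apply: cvgM; exact: coord.
Qed.

Lemma coord_norm_le u j : `|u 0 j| <= `|u|.
Proof.
rewrite /Num.norm/= mx_normrE.
exact: (le_bigmax _ (fun ij : 'I_1 * 'I_n => `|u ij.1 ij.2|) (0, j)).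
Qed.

Lemma normr_inner_product_le v w :
  `|inner_product v w| <= n%:R * (`|v| * `|w|).
Proof.
apply: (le_trans (ler_norm_sum _ _ _)).
rewrite -[n in n%:R]card_ord -sum1_card natr_sum mulr_suml.
apply: ler_sum => j _; rewrite mul1r normrM.
by apply: ler_pM => //; exact: coord_norm_le.
Qed.

End InnerProduct.

Lemma inner_product_gt0_near {R : realType} {n : nat} (v w : 'rV[R]_n) :
  0 < inner_product v w -> exists2 eta, 0 < eta &
    forall v' w', `|v - v'| <= eta -> `|w - w'| <= eta -> 0 < inner_product v' w'.
Proof.
move=> vw0.
have lim : inner_product p.1 p.2 @[p --> (v, w)] --> inner_product v w.
  by apply: inner_product_continuous; [exact: cvg_fst|exact: cvg_snd].
have : \forall p \near (v, w), 0 < inner_product p.1 p.2 by exact: (cvgr_gt _ lim).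
move=> /nbhs_ballP[r /= r0 hr].
exists (r / 2) => [|v' w' hv hw]; first exact: divr_gt0.
have r2 : r / 2 < r by rewrite ltr_pdivrMr// ltr_pMr// ltr1n.
by apply: (hr (v', w')); split; rewrite -ball_normE /=; exact: le_lt_trans r2.
Qed.

(** * First-order estimates *)

Section Gradient.
Context {R : realType} {n : nat}.
Implicit Types (f : 'rV[R]_n -> R) (x y z v : 'rV[R]_n).

Lemma diff_inner_product f x v :
  differentiable f x -> 'd f x v = inner_product (grad f x) v.
Proof.
move=> df; rewrite {1}(row_sum_delta v) linear_sum.
by apply: eq_bigr => j _; rewrite linearZ mxE deriveE//= mulrC.
Qed.

(** The mean value theorem on the segment from [p.2] to [p.1] turns continuity
    of the gradient into a first-order estimate in which both end points vary. *)
Lemma strict_differentiability f x :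
    (forall y, differentiable f y) -> {for x, continuous (grad f)} ->
  forall eps, 0 < eps -> \forall p \near (x, x),
    `|f p.1 - f p.2 - inner_product (grad f x) (p.1 - p.2)|
      <= eps * `|p.1 - p.2|.
Proof.
move=> df cf eps eps0.
have n0 : 0 < n.+1%:R :> R by rewrite ltr0n.
have /cvgrPdist_lt/(_ (eps / n.+1%:R)) := cf.
rewrite divr_gt0// => /(_ isT)/nbhs_ballP[r /= r0 hr].
apply/nbhs_ballP; exists r => // -[y z] [/= xy xz].
pose seg (t : R) := z + t *: (y - z).
have dseg t : is_derive t (1 : R) (f \o seg) (inner_product (grad f (seg t)) (y - z)).
  have E : (fun h : R => h^-1 *: (((f \o seg) \o shift t) (h *: 1) - (f \o seg) t))
     = (fun h => h^-1 *: ((f \o shift (seg t)) (h *: (y - z)) - f (seg t))).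
    apply/funext => h /=; congr (_ *: (f _ - _)).
    by rewrite /seg [h *: 1]mulr1 scalerDl addrCA addrA.
  have D : derivable f (seg t) (y - z) by exact: diff_derivable.
  split; first by rewrite /derivable E.
  by rewrite -(diff_inner_product _ _ _ (df _)) -(deriveE _ (df _)) /derive E.
have cseg : {within `[0, 1], continuous (f \o seg)}.
  by apply: derivable_within_continuous => t _; have [] := dseg t.
have [t] := MVT ltr01 (fun t _ => dseg t) cseg.
rewrite in_itv/= => /andP[t0 t1].
rewrite /seg/= scale1r scale0r addr0 subr0 mulr1 [z + _]addrC subrK => ->.
have xs : ball x r (seg t).
  have -> : seg t = t *: y + (1 - t) *: z.
    by rewrite /seg scalerBr scalerBl scale1r addrC addrAC addrA.
  move: xy xz; rewrite -!ball_normE /= => xy xz.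
  have -> : x - (t *: y + (1 - t) *: z) = t *: (x - y) + (1 - t) *: (x - z).
    rewrite !scalerBr addrACA -opprD; congr (_ - _).
    by rewrite -scalerDl subrKC scale1r.
  rewrite (le_lt_trans (ler_normD _ _))// !normrZ !ger0_norm; [|lra..].
  have -> : r = t * r + (1 - t) * r by rewrite -mulrDl subrKC mul1r.
  by rewrite ltrD// ltr_pM2l// subr_gt0.
rewrite -[inner_product (grad f x) _]inner_productC.
rewrite [X in X - _]inner_productC -inner_productNr -inner_productDr.
apply: (le_trans (normr_inner_product_le _ _)).
rewrite mulrCA mulrC ler_wpM2r//.
have /= gs := ltW (hr _ xs).
apply: (@le_trans _ _ (n.+1%:R * (eps / n.+1%:R))).
  apply: ler_pM; [exact: ler0n|exact: normr_ge0|by rewrite ler_nat|].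
  by rewrite distrC.
by rewrite mulrC divfK// gt_eqF.
Qed.

End Gradient.

(** * Lifting changes of the constraint values *)

Definition dual_rows {R : realType} {n N : nat} (G : 'I_N -> 'rV[R]_n -> R)
    (x0 : 'rV[R]_n) (W : 'M[R]_(N, n)) : Prop :=
  forall a b, inner_product (grad (G a) x0) (row b W) = (a == b)%:R.

Lemma dual_pairing {R : realType} {n N : nat} (G : 'I_N -> 'rV[R]_n -> R)
    (W : 'M[R]_(N, n)) (x0 : 'rV[R]_n) a (u : 'rV[R]_N) :
    dual_rows G x0 W ->
  inner_product (grad (G a) x0) (u *m W) = u 0 a.
Proof.
move=> dual.
rewrite mulmx_sum_row inner_product_sumr (bigD1 a)//= inner_productZr dual.
rewrite eqxx mulr1 big1 ?addr0// => b ba.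
by rewrite inner_productZr dual eq_sym (negbTE ba) mulr0.
Qed.

(** The coordinate functionals of a free family, represented by vectors through
    the inner product. *)
Lemma free_dual_family {R : realType} {n N : nat} (X : N.-tuple 'rV[R]_n) :
  free X -> exists W : 'M[R]_(N, n),
    forall a b : 'I_N, inner_product X`_a (row b W) = (a == b)%:R.
Proof.
move=> freeX; exists (\matrix_(b, j) coord X b (delta_mx 0 j)) => a b.
rewrite -(coord_free a b freeX).
move: (X`_a) => v; rewrite [v in RHS]row_sum_delta linear_sum.
by apply: eq_bigr => j _; rewrite linearZ !mxE.
Qed.

(** Norm and completeness of matrix spaces are joined here, as Banach's fixed
    point theorem lives on complete normed modules. *)
HB.instance Definition _ (R : realType) (m n : nat) := Complete.on 'M[R]_(m, n).

Lemma norm_mulmx_le {R : realType} {N n : nat} (u : 'rV[R]_N) (W : 'M[R]_(N, n)) :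
  `|u *m W| <= (\sum_a `|row a W|) * `|u|.
Proof.
rewrite mulmx_sum_row (le_trans (ler_norm_sum _ _ _))// mulr_suml.
apply: ler_sum => a _; rewrite normrZ mulrC ler_wpM2l//.
exact: coord_norm_le.
Qed.

(** In the coordinates [u |-> x + u *m W] the map [G] differs from the identity
    by a map with arbitrarily small Lipschitz constant, whatever the base point
    [x] near [x0]; the lift is the fixed point of the resulting contraction.
    Uniformity in [x] is what makes the lemma usable at all the points of a
    sequence that tends to [x0]. *)
Lemma local_lifting {R : realType} {n N : nat} (G : 'I_N -> 'rV[R]_n -> R)
    (W : 'M[R]_(N, n)) (x0 : 'rV[R]_n) :
    (forall a, continuously_differentiable (G a)) ->
    dual_rows G x0 W ->
  forall eps, 0 < eps -> exists2 r, 0 < r &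
    forall x (e : 'rV[R]_N), ball x0 r x -> `|e| <= r ->
      exists2 u, `|u - e| <= eps * `|e| &
        forall a, G a (x + u *m W) = G a x + e 0 a.
Proof.
move=> CG dual eps eps0.
pose C := \sum_a `|row a W| + 1.
have C0 : 0 < C by rewrite ltr_wpDl// sumr_ge0.
have normW (u : 'rV[R]_N) : `|u *m W| <= C * `|u|.
  by rewrite (le_trans (norm_mulmx_le _ _))// ler_wpM2r// lerDl.
(* The bound 1/2 keeps the ball of radius [2 * `|e|] stable under the
   iteration; eps / 2 then yields the estimate on [u - e]. *)
pose q := Num.min (2^-1) (eps / 2).
have q0 : 0 < q by rewrite lt_min invr_gt0 ltr0n divr_gt0.
have q2 : q <= 2^-1 by rewrite ge_min lexx.
have qe : q <= eps / 2 by rewrite ge_min lexx orbT.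
have /filter_forall/nbhs_ballP[rho /= rho0 hrho] : forall a, \forall p \near (x0, x0),
    `|G a p.1 - G a p.2 - inner_product (grad (G a) x0) (p.1 - p.2)|
      <= q / C * `|p.1 - p.2|.
  move=> a; apply: strict_differentiability; [exact: (CG a).1|exact: (CG a).2|].
  exact: divr_gt0.
have D0 : 0 < 1 + 2 * C by rewrite addr_gt0// mulr_gt0.
(* With this radius, [x + u *m W] stays within [rho] of [x0] as long as
   [`|u| <= 2 * `|e|]. *)
exists (rho / (1 + 2 * C)); first by rewrite divr_gt0.
move=> x e xr er.
pose T (u : 'rV[R]_N) := u - \row_a (G a (x + u *m W) - G a x - e 0 a).
pose U := [set u : 'rV[R]_N | `|u| <= 2 * `|e|].
have near_x0 u : U u -> ball x0 rho (x + u *m W).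
  move: xr; rewrite -!ball_normE /= => xr Uu.
  rewrite opprD addrA (le_lt_trans (ler_normB _ _))//.
  have uW : `|u *m W| <= C * (2 * (rho / (1 + 2 * C))).
    apply: (le_trans (normW _)); apply: (ler_wpM2l (ltW C0)).
    by apply: (le_trans Uu); exact: ler_wpM2l.
  apply: (lt_le_trans (ltr_leD xr uW)).
  rewrite -[leRHS](divfK (lt0r_neq0 D0)); set k := rho / _.
  by rewrite le_eqVlt; apply/orP; left; apply/eqP; ring.
have contr u v : U u -> U v -> `|T u - T v| <= q * `|u - v|.
  move=> Uu Uv.
  rewrite {1}/Num.norm/= mx_normrE; apply/bigmax_leP; split => [|[i a] _ /=].
    exact: mulr_ge0 (ltW q0) (normr_ge0 _).
  rewrite ord1.
  have /= := hrho (_, _) (conj (near_x0 _ Uu) (near_x0 _ Uv)) a.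
  rewrite opprD addrACA subrr add0r -mulmxBl (dual_pairing _ _ _ _ _ dual) => h.
  rewrite -[leLHS]normrN !mxE.
  have -> : - (u 0 a - (G a (x + u *m W) - G a x - e 0 a) -
      (v 0 a - (G a (x + v *m W) - G a x - e 0 a))) =
     G a (x + u *m W) - G a (x + v *m W) - (u 0 a - v 0 a) by ring.
  rewrite !mxE in h; apply: (le_trans h).
  by rewrite -mulrA (ler_wpM2l (ltW q0))// ler_pdivrMl.
have T0 : T 0 = e.
  by apply/rowP => a; rewrite !mxE mul0mx addr0 subrr !sub0r opprK.
have U0 : U 0 by rewrite /U/= normr0 mulr_ge0.
have TU : {homo T : u / U u}.
  move=> u Uu; rewrite /U /= -[T u](subrK (T 0)) T0 (le_trans (ler_normD _ _))//.
  rewrite mulr_natl mulr2n lerD2r -[X in _ - X]T0 (le_trans (contr _ _ Uu U0))// subr0.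
  apply: (@le_trans _ _ (2^-1 * (2 * `|e|))); first by apply: ler_pM => //; exact: ltW.
  by rewrite mulrA mulVf ?mul1r.
have [|||u Uu Tu] := @banach_fixed_point R 'rV[R]_N U (mkfun_fun TU).
- exists (NngNum (ltW q0)); split => /=; first by rewrite (le_lt_trans q2)// invf_lt1 ?ltr1n.
  by move=> [u v] [/= Uu Uv]; exact: contr.
- rewrite (_ : U = closed_ball_ Num.norm 0 (2 * `|e|)); first exact: closed_closed_ball_.
  by apply/seteqP; split => u; rewrite /closed_ball_ /U/= sub0r normrN.
- by exists 0.
exists u.
  rewrite {1}Tu -{1}T0 (le_trans (contr _ _ Uu U0))// subr0.
  apply: (@le_trans _ _ (eps / 2 * (2 * `|e|))); first by apply: ler_pM => //; exact: ltW.
  by rewrite mulrA divfK.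
move=> a; have /rowP/(_ a) := Tu; rewrite !mxE => h; lra.
Qed.

Lemma lifted_sequence {R : realType} {n N : nat} (G : 'I_N -> 'rV[R]_n -> R)
    (W : 'M[R]_(N, n)) (x0 : 'rV[R]_n) (e : 'rV[R]_N) :
    (forall a, continuously_differentiable (G a)) ->
    dual_rows G x0 W ->
  exists (x : nat -> 'rV[R]_n) (t : nat -> R),
    [/\ x @ \oo --> x0, forall k, 0 < t k &
        forall k a, G a (x k) = G a x0 + t k * e 0 a].
Proof.
move=> CG dual.
have [r r0 lift] := local_lifting G W x0 CG dual 1 ltr01.
have e1 : 0 < `|e| + 1 by rewrite ltr_wpDl.
pose t (k : nat) := r / (`|e| + 1) * k.+1%:R^-1.
have t0 k : 0 < t k by rewrite mulr_gt0 ?divr_gt0// invr_gt0 ltr0n.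
have tlim : t @ \oo --> 0.
  rewrite -[X in _ --> X](mulr0 (r / (`|e| + 1))).
  by apply: cvgM; [exact: cvg_cst|exact: cvg_harmonic].
have tr k : `|t k *: e| <= r.
  rewrite normrZ gtr0_norm// /t mulrAC -[leRHS]mulr1.
  apply: ler_pM => //.
  - by rewrite mulr_ge0// divr_ge0// ltW.
  - by rewrite -[leRHS](divfK (lt0r_neq0 e1)) ler_wpM2l ?lerDl// divr_ge0// ltW.
  - by rewrite invf_le1 ?ltr0n// ler1n.
have /choice[u hu] k : exists u, `|u - t k *: e| <= `|t k *: e| /\
    forall a, G a (x0 + u *m W) = G a x0 + (t k *: e) 0 a.
  have [u ue Gu] := lift x0 (t k *: e) (ballxx _ r0) (tr k).
  by exists u; split => //; rewrite -[leRHS]mul1r.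
exists (fun k => x0 + u k *m W), t; split => // [|k a]; last first.
  by have [_ ->] := hu k; rewrite mxE.
have uW0 : u k *m W @[k --> \oo] --> 0.
  apply: norm_cvg0.
  apply: (@squeeze_cvgr _ _ _ _ (cst 0)
    (fun k => (\sum_a `|row a W|) * ((2 * `|e|) * t k))); last 2 first.
  - exact: cvg_cst.
  - rewrite -[X in _ --> X](mulr0 (\sum_a `|row a W|)); apply: cvgM; first exact: cvg_cst.
    by rewrite -[X in _ --> X](mulr0 (2 * `|e|)); apply: cvgM => //; exact: cvg_cst.
  apply: filterE => k; rewrite normr_ge0/= (le_trans (norm_mulmx_le _ _))//.
  apply: ler_wpM2l; first by rewrite sumr_ge0.
  have [ue _] := hu k.
  rewrite -[u k](subrK (t k *: e)) (le_trans (ler_normD _ _))//.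
  rewrite (le_trans (lerD ue (lexx _)))// normrZ gtr0_norm//.
  by rewrite le_eqVlt; apply/orP; left; apply/eqP; ring.
by rewrite -[X in _ --> X]addr0; apply: cvgD => //; exact: cvg_cst.
Qed.

(** * Tangents and normals of a set *)

(** By compactness the displacement directions [z] accumulate at a tangent, even
    if they do not converge as [t] tends to 0. *)
Lemma tangent_in_compact {R : realType} {n : nat} (M C : set 'rV[R]_n) x :
    compact C ->
    (forall d, 0 < d -> exists t z, [/\ 0 < t, t < d, C z & M (x + t *: z)]) ->
  exists2 w, C w & tangential_cone M x w.
Proof.
move=> cC small.
have /choice[p hp] (k : nat) : exists p : R * 'rV[R]_n,
    [/\ 0 < p.1, p.1 < k.+1%:R^-1, C p.2 & M (x + p.1 *: p.2)].
  by have [|t [z h]] := small k.+1%:R^-1; [rewrite invr_gt0 ltr0n|exists (t, z)].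
have [|w [Cw wcl]] := cC _ (fmap_proper_filter (fun k => (p k).2) eventually_filter).
  by exists 0%N => // k _; have [] := hp k.
have /choice[s hs] (k : nat) : exists j, (k <= j)%N /\ `|w - (p j).2| < k.+1%:R^-1.
  have tail : ((fun k => (p k).2) @ \oo) [set (p j).2 | j in [set j | (k <= j)%N]].
    by exists k => // j /= kj; exists j.
  have [|z [[j /= kj <-] wz]] := wcl _ (ball w k.+1%:R^-1) tail.
    by apply: nbhsx_ballx; rewrite invr_gt0 ltr0n.
  by exists j; split => //; move: wz; rewrite -ball_normE.
have zw : (p (s k)).2 @[k --> \oo] --> w.
  apply/cvgrPdist_lt => e e0; near=> k.
  have [_ h] := hs k; apply: (lt_trans h).
  near: k; exact: near_infty_natSinv_lt (PosNum e0).
have t0 : (p (s k)).1 @[k --> \oo] --> 0.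
  apply/cvgrPdist_lt => e e0; near=> k.
  have [p0 p1 _ _] := hp (s k).
  rewrite sub0r normrN gtr0_norm// (lt_trans p1)//.
  apply: (@le_lt_trans _ _ k.+1%:R^-1).
    by rewrite lef_pV2 ?posrE ?ltr0n// ler_nat ltnS; have [] := hs k.
  near: k; exact: near_infty_natSinv_lt (PosNum e0).
exists w => //; exists (fun k => x + (p (s k)).1 *: (p (s k)).2), (fun k => (p (s k)).1).
split => //.
- by move=> k; have [] := hp (s k).
- rewrite -[X in _ --> X]addr0 -[X in _ + X](scale0r w).
  by apply: cvgD; [exact: cvg_cst|exact: cvgZ].
- by move=> k; have [] := hp (s k).
- apply: cvg_trans zw; apply: near_eq_cvg; near=> k.
  by rewrite addrC addKr scalerA mulVf ?scale1r//; have [/gt_eqF ->] := hp (s k).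
Unshelve. all: by end_near. Qed.

(** If [M] allows the constraint values at [x] to move along [e], then lifting
    these moves produces a tangent of [M] at [x].  It is only known up to [eta]:
    its exact direction depends on the gradients at [x], whereas [e *m W] is
    computed from those at [x0]. *)
Lemma approximate_tangent {R : realType} {n N : nat} (G : 'I_N -> 'rV[R]_n -> R)
    (W : 'M[R]_(N, n)) (x0 : 'rV[R]_n) (M : set 'rV[R]_n) (e : 'rV[R]_N) (eta : R) :
    (forall a, continuously_differentiable (G a)) ->
    dual_rows G x0 W ->
    0 < eta ->
  \forall x \near x0,
    (forall t y, 0 < t -> (forall a, G a y = G a x + t * e 0 a) -> M y) ->
    exists2 w, `|e *m W - w| <= eta & tangential_cone M x w.
Proof.
move=> CG dual eta0.
pose D := (\sum_a `|row a W| + 1) * (`|e| + 1).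
have D0 : 0 < D by rewrite mulr_gt0// ltr_wpDl// sumr_ge0.
have [r r0 lift] := local_lifting G W x0 CG dual (eta / D) (divr_gt0 eta0 D0).
apply/nbhs_ballP; exists r => //= x xr Mx.
have [||w ew Tw] := @tangent_in_compact _ _ M (closed_ball_ Num.norm (e *m W) eta) x.
- apply: bounded_closed_compact; last exact: closed_closed_ball_.
  exists (`|e *m W| + eta); split; first exact: num_real.
  move=> B hB z; rewrite /closed_ball_ /= => ez.
  rewrite (le_trans _ (ltW hB))// -[z](subKr (e *m W)) (le_trans (ler_normB _ _))//.
  by rewrite lerD2l.
- move=> d d0.
  pose t := Num.min (d / 2) (r / (`|e| + 1)).
  have e1 : 0 < `|e| + 1 by rewrite ltr_wpDl.
  have t0 : 0 < t by rewrite lt_min !divr_gt0.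
  have td : t < d by rewrite gt_min ltr_pdivrMr// ltr_pMr// ltr1n.
  have ter : `|t *: e| <= r.
    rewrite normrZ gtr0_norm//.
    apply: (@le_trans _ _ (r / (`|e| + 1) * (`|e| + 1))); last by rewrite divfK// gt_eqF.
    apply: ler_pM; [exact: ltW|exact: normr_ge0|by rewrite ge_min lexx orbT|].
    by rewrite lerDl.
  have [u ue Gu] := lift x (t *: e) xr ter.
  exists t, (t^-1 *: u *m W); split => //.
    rewrite /closed_ball_ /= -mulmxBl (le_trans (norm_mulmx_le _ _))//.
    have ut : `|e - t^-1 *: u| <= eta / D * `|e|.
      rewrite -[e in X in X <= _](scale1r) -(mulVf (lt0r_neq0 t0)) -scalerA -scalerBr.
      rewrite normrZ gtr0_norm ?invr_gt0// ler_pdivrMl// distrC (le_trans ue)//.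
      by rewrite normrZ gtr0_norm// mulrCA.
    apply: (@le_trans _ _ ((\sum_a `|row a W| + 1) * (eta / D * (`|e| + 1)))).
      apply: ler_pM => //; first by rewrite sumr_ge0.
        by rewrite lerDl.
      apply: (le_trans ut); apply: ler_wpM2l; last by rewrite lerDl.
      by rewrite divr_ge0// ltW.
    by rewrite mulrCA -/D divfK// gt_eqF.
  rewrite -scalemxAl scalerA mulfV ?gt_eqF// scale1r.
  by apply: (Mx t) => // a; rewrite Gu mxE.
- by exists w.
Qed.

(** The direction of [y k - x] is [w] only in the limit, so this needs more than
    the directional derivative of [f] along [w]. *)
Lemma difference_quotient_cvg {R : realType} {n : nat} (f : 'rV[R]_n -> R) x w
    (y : nat -> 'rV[R]_n) (tau : nat -> R) :
    differentiable f x -> y @ \oo --> x -> (forall k, 0 < tau k) ->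
    (tau k)^-1 *: (y k - x) @[k --> \oo] --> w ->
  (tau k)^-1 * (f (y k) - f x) @[k --> \oo] --> inner_product (grad f x) w.
Proof.
move=> df yx tau0 yw.
have gw : inner_product (grad f x) ((tau k)^-1 *: (y k - x)) @[k --> \oo]
    --> inner_product (grad f x) w.
  by apply: inner_product_continuous => //; exact: cvg_cst.
apply: (cvg_sub0 _ gw).
apply/cvgrPdist_le => e e0.
have B0 : 0 < `|w| + 1 by rewrite ltr_wpDl.
have /eqaddoP/(_ _ (divr_gt0 e0 B0)) := diff_locally df.
have yx0 : y k - x @[k --> \oo] --> 0 by apply/subr_cvg0.
move=> small.
have approx : \forall k \near \oo,
    `|f (y k) - (f x + 'd f x (y k - x))| <= e / (`|w| + 1) * `|y k - x|.
  have h : \forall k \near \oo, `|(f \o shift x - (cst (f x) + 'd f x)) (y k - x)|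
      <= e / (`|w| + 1) * `|y k - x| := yx0 _ small.
  apply: filterS h => k /=.
  by rewrite -[(_ - _ : _ -> _) _]/(_ - _) -[(_ + _ : _ -> _) _]/(_ + _) /= subrK.
have /cvgrPdist_lt/(_ _ ltr01) yw1 := yw.
near=> k.
rewrite sub0r normrN/=.
have tk := tau0 k.
rewrite [X in `|X|](_ : _ = (tau k)^-1 * (f (y k) - (f x + 'd f x (y k - x)))); last first.
  rewrite -[(_ - _ : _ -> _) _]/(_ - _).
  by rewrite (diff_inner_product _ _ _ df) inner_productZr -mulrBr opprD addrA.
rewrite normrM gtr0_norm ?invr_gt0//.
have ak : `|f (y k) - (f x + 'd f x (y k - x))| <= e / (`|w| + 1) * `|y k - x|.
  by near: k.
have wk : `|w - (tau k)^-1 *: (y k - x)| < 1 by near: k.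
have {}wk : (tau k)^-1 * `|y k - x| <= `|w| + 1.
  rewrite -[X in X * _]gtr0_norm ?invr_gt0// -normrZ.
  rewrite -[_ *: _](subrK w) addrC (le_trans (ler_normD _ _))// lerD2l distrC.
  exact: ltW.
apply: (@le_trans _ _ ((tau k)^-1 * (e / (`|w| + 1) * `|y k - x|))).
  by rewrite ler_wpM2l// invr_ge0 ltW.
rewrite mulrCA -[leRHS](divfK (lt0r_neq0 B0)) ler_wpM2l//.
by rewrite divr_ge0// ltW.
Unshelve. all: by end_near. Qed.

(** First-order necessary optimality condition: along a tangent sequence the
    difference quotients of the minimised function are nonnegative. *)
Lemma frechet_normal_of_local_min {R : realType} {n : nat} (I : finType)
    (G : I -> 'rV[R]_n -> R) (c : I -> R) (M : set 'rV[R]_n) x :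
    (forall a, differentiable (G a) x) ->
    (\forall y \near x, M y -> \sum_a c a * G a x <= \sum_a c a * G a y) ->
  frechet_normal_cone M x (- \sum_a c a *: grad (G a) x).
Proof.
move=> dG minx w [y [tau [My yx tau0 _ yw]]].
rewrite inner_productC inner_productNr oppr_le0 inner_product_sumr.
have lim : \sum_a c a * ((tau k)^-1 * (G a (y k) - G a x)) @[k --> \oo] -->
    \sum_a inner_product w (c a *: grad (G a) x).
  apply: (cvg_big (@add_continuous R)) => a _.
  rewrite inner_productZr inner_productC.
  by apply: cvgM; [exact: cvg_cst|exact: difference_quotient_cvg].
apply: (cvgr_to_ge lim).
near=> k.
have : \sum_a c a * G a x <= \sum_a c a * G a (y k).
  have h : M (y k) -> \sum_a c a * G a x <= \sum_a c a * G a (y k).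
    by near: k; exact: yx minx.
  exact/h/My.
rewrite -subr_ge0 -sumrB => h.
under eq_bigr do rewrite mulrCA mulrBr.
by rewrite -mulr_sumr mulr_ge0// invr_ge0 ltW.
Unshelve. all: by end_near. Qed.

(** The limit of [v] has the inner product [c b ^+ 2 > 0] with the direction
    [- c b *: row b W].  If the [b]-th constraint value could be moved in that
    direction inside [M], a tangent of [M] at [x k] would form an acute angle
    with the normal [v k]. *)
Lemma blocked_direction {R : realType} {n N : nat} (G : 'I_N -> 'rV[R]_n -> R)
    (W : 'M[R]_(N, n)) (x0 : 'rV[R]_n) (M : set 'rV[R]_n) (c : 'I_N -> R) b
    (x v : nat -> 'rV[R]_n) :
    (forall a, continuously_differentiable (G a)) ->
    dual_rows G x0 W ->
    x @ \oo --> x0 -> v @ \oo --> - \sum_a c a *: grad (G a) x0 ->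
    (forall k, frechet_normal_cone M (x k) (v k)) -> c b != 0 ->
  \forall k \near \oo, ~ forall t y, 0 < t ->
    (forall a, G a y = G a (x k) - t * (c b * (a == b)%:R)) -> M y.
Proof.
move=> CG dual xx0 vlim vN cb0.
pose e := \row_a (- (c b * (a == b)%:R)).
have [|eta eta0 pos] := inner_product_gt0_near (- \sum_a c a *: grad (G a) x0) (e *m W).
  rewrite inner_productC inner_productNr inner_product_sumr (bigD1 b)//= big1.
    rewrite addr0 inner_productZr inner_productC (dual_pairing _ _ _ _ _ dual) mxE.
    by rewrite eqxx mulr1 mulrN opprK -expr2 exprn_even_gt0.
  move=> a ab; rewrite inner_productZr inner_productC (dual_pairing _ _ _ _ _ dual) mxE.
  by rewrite (negbTE ab) !(mulr0, oppr0).
have /cvgrPdist_le/(_ _ eta0) vnear := vlim.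
have tnear := xx0 _ (approximate_tangent G W x0 M e eta CG dual eta0).
near=> k => esc.
have [w ew Tw] : exists2 w, `|e *m W - w| <= eta & tangential_cone M (x k) w.
  have : (forall t y, 0 < t -> (forall a, G a y = G a (x k) + t * e 0 a) -> M y) ->
    exists2 w, `|e *m W - w| <= eta & tangential_cone M (x k) w.
    by near: k; exact: tnear.
  by apply=> t y t0 Gy; apply: (esc t) => // a; rewrite Gy mxE mulrN.
have vk : `|- \sum_a c a *: grad (G a) x0 - v k| <= eta by near: k.
by have := pos _ _ vk ew; rewrite ltNge vN.
Unshelve. all: by end_near. Qed.

(** * The five planar cones *)

(** At each point of the cone one coordinate leaves the other one free to move
    without bound, in the direction opposite to its multiplier: a coordinate that
    vanishes, or is nonpositive for the vanishing cone, or is nonnegative for the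
    disjunctive one.  For complementarity with two positive multipliers the origin
    would admit neither move, which is why the sign conditions of a saddle are
    needed. *)
Lemma cone_escape_direction {R : realType} (K : cone_type) (l1 l2 : R) :
    T_condition K l1 l2 -> saddle_condition K l1 l2 -> l1 <> 0 -> l2 <> 0 ->
  forall a, cone K a ->
    (forall t, 0 < t -> cone K (a.1 - t * l1, a.2)) \/
    (forall t, 0 < t -> cone K (a.1, a.2 - t * l2)).
Proof.
move=> + [_ +] /eqP l10 /eqP l20 [a1 a2].
have neg (l : R) : l <= 0 -> forall t, 0 < t -> 0 <= - (t * l).
  by move=> l0 t t0; rewrite -mulrN mulr_ge0 ?oppr_ge0// ltW.
case: K => /=.
- move=> _ [l1n l2n] [/eqP]; rewrite mulf_eq0 => /orP[]/eqP -> p q; [right|left] => t t0;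
    by rewrite ?mul0r ?mulr0; split => //; rewrite addr_ge0// neg.
- move=> _ [l1n l2n] [p q]; have [a2n|a2p] := leP a2 0; [left|right] => t t0.
    have h : 0 <= a1 - t * l1 by rewrite addr_ge0// neg.
    by split => //; rewrite mulr_ge0_le0.
  have -> : a1 = 0 by apply/eqP; rewrite eq_le p andbT; move: q; rewrite pmulr_lle0.
  by split; rewrite ?mul0r.
- move=> _ l2n [/eqP]; rewrite mulf_eq0 => /orP[]/eqP -> p; [right|left] => t t0;
    by rewrite ?mul0r ?mulr0; split => //; rewrite addr_ge0// neg.
- by move=> _ _ /eqP; rewrite mulf_eq0 => /orP[]/eqP ->; [right|left] => t t0;
    rewrite ?mul0r ?mulr0.
- move=> [_ _] [_ _] [p|p]; [right|left] => t t0; [by left|by right].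
Qed.

(** The ray follows the axis of a vanishing multiplier: near it the other
    coordinate of the points of the cone is zero or has the sign that the
    T-stationarity condition requires. *)
Lemma nonregular_cone_ray {R : realType} (K : cone_type) (l1 l2 : R) :
    T_condition K l1 l2 -> ~ [/\ saddle_condition K l1 l2, l1 <> 0 & l2 <> 0] ->
  exists d : R * R, forall t, 0 < t ->
    [/\ cone K (t * d.1, t * d.2), l1 * (t * d.1) + l2 * (t * d.2) = 0 &
      \forall a \near (t * d.1, t * d.2), cone K a -> 0 <= l1 * a.1 + l2 * a.2].
Proof.
move=> TK nreg.
have near1 (s : R) (b : R * R) : 0 < s * b.1 -> \forall a \near b, 0 < s * a.1.
  have lim : s * a.1 @[a --> b] --> s * b.1.
    by apply: cvgM; [exact: cvg_cst|exact: cvg_fst].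
  exact: (cvgr_gt _ lim).
have near2 (s : R) (b : R * R) : 0 < s * b.2 -> \forall a \near b, 0 < s * a.2.
  have lim : s * a.2 @[a --> b] --> s * b.2.
    by apply: cvgM; [exact: cvg_cst|exact: cvg_snd].
  exact: (cvgr_gt _ lim).
(* For the disjunctive cone the positive half axes are interior, and the ray
   has to follow the negative ones, which lie on the boundary. *)
pose s : R := if K is Disjunctive then -1 else 1.
have ss : s * s = 1 by rewrite /s; case: (K) => /=; rewrite ?mulrNN mulr1.
have [l10|l10] := eqVneq l1 0.
  exists (s, 0) => t t0 /=; rewrite l10 mul0r !mulr0 addr0; split => //.
    by rewrite /s; case: (K) => /=; rewrite ?mulr0 ?mulr1 ?mulrN1;
      [split; rewrite // ltW|split; rewrite // ltW|split| |right].
  apply: filterS (near1 s _ _) => /=; last by rewrite mulrCA ss mulr1.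
  move=> [a1 a2] /=; rewrite mul0r add0r; move: TK; rewrite l10 /s.
  case: (K) => /=; rewrite ?mul1r ?mulN1r.
  - by move=> _ a10 [/eqP]; rewrite mulf_eq0 gt_eqF//= => /eqP ->; rewrite mulr0.
  - by move=> [_ l2n] a10 [_]; rewrite pmulr_rle0// => a2n; rewrite mulr_le0.
  - by move=> _ a10 [/eqP]; rewrite mulf_eq0 gt_eqF//= => /eqP ->; rewrite mulr0.
  - by move=> _ a10 /eqP; rewrite mulf_eq0 gt_eqF//= => /eqP ->; rewrite mulr0.
  - rewrite oppr_gt0 => -[_ l2p] a10 [|a2p]; first by rewrite leNgt a10.
    by rewrite mulr_ge0.
have [l20|l20] := eqVneq l2 0.
  exists (0, s) => t t0 /=; rewrite l20 mul0r !mulr0 addr0; split => //.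
    by rewrite /s; case: (K) => /=; rewrite ?mul0r ?mulr1 ?mulrN1;
      [split; rewrite // ltW|split|split; rewrite // ltW| |left].
  apply: filterS (near2 s _ _) => /=; last by rewrite mulrCA ss mulr1.
  move=> [a1 a2] /=; rewrite mul0r addr0; move: TK; rewrite l20 /s.
  case: (K) => /=; rewrite ?mul1r ?mulN1r.
  - by move=> _ a20 [/eqP]; rewrite mulf_eq0 (gt_eqF a20) orbF => /eqP ->; rewrite mulr0.
  - move=> _ a20 [a1p]; rewrite pmulr_lle0// => a1n.
    have -> : a1 = 0 by apply/eqP; rewrite eq_le a1n.
    by rewrite mulr0.
  - by move=> _ a20 [/eqP]; rewrite mulf_eq0 (gt_eqF a20) orbF => /eqP ->; rewrite mulr0.
  - by move=> _ a20 /eqP; rewrite mulf_eq0 (gt_eqF a20) orbF => /eqP ->; rewrite mulr0.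
  - rewrite oppr_gt0 => -[l1p _] a20 [a1p|]; last by rewrite leNgt a20.
    by rewrite mulr_ge0.
have nsaddle : ~ saddle_condition K l1 l2.
  by move=> sad; apply: nreg; split => //; exact/eqP.
have nz : (l1, l2) <> (0, 0) by case=> /eqP; rewrite (negbTE l10).
(* Both multipliers are nonzero, so the saddle condition fails; only
   complementarity with two positive multipliers is compatible with that. *)
exists (0, 0) => t t0 /=; rewrite !mulr0 addr0.
move: {s ss near1 near2 nreg} TK nsaddle; case: K => /=.
- move=> l12 nsad; have [l1p l2p] : 0 < l1 /\ 0 < l2.
    have [l1p|l1n] := ltP 0 l1; first by rewrite pmulr_rge0// le_eqVlt eq_sym (negbTE l20) in l12.
    have {}l1n : l1 < 0 by rewrite lt_neqAle l10.
    by exfalso; apply: nsad; split => //; split; [exact: ltW|rewrite -(nmulr_rge0 _ l1n)].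
  split; rewrite ?mulr0//; apply: filterE => -[a1 a2] /= [_ a1p a2p].
  by rewrite addr_ge0// mulr_ge0// ltW.
- move=> [l12 l2n]; case; split => //; split => //.
  have l2l : l2 < 0 by rewrite lt_neqAle l20.
  by rewrite -(nmulr_lge0 _ l2l).
- by move=> [/eqP|l2n]; [rewrite (negbTE l10)|case; split].
- by move=> _; case; split.
- by move=> l12; case; split.
Qed.

(** * The feasible set *)

(** Stacking the two families makes the constraints a single family, to which
    the results on coordinates apply. *)
Definition stack {T : Type} {m : nat} (p q : 'I_m -> T) (a : 'I_(m + m)) : T :=
  match fintype.split a with inl i => p i | inr i => q i end.

Lemma stackl {T : Type} {m : nat} (p q : 'I_m -> T) i :
  stack p q (lshift m i) = p i.
Proof. by rewrite /stack (unsplitK (inl i)). Qed.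

Lemma stackr {T : Type} {m : nat} (p q : 'I_m -> T) i :
  stack p q (rshift m i) = q i.
Proof. by rewrite /stack (unsplitK (inr i)). Qed.

Lemma stackP {T : Type} {m : nat} (P : T -> Prop) (p q : 'I_m -> T) :
  (forall i, P (p i)) -> (forall i, P (q i)) -> forall a, P (stack p q a).
Proof. by move=> Pp Pq a; rewrite /stack; case: fintype.split. Qed.

Lemma sum_stack {V : nmodType} {m : nat} (h : 'I_(m + m) -> V) :
  \sum_a h a = \sum_i (h (lshift m i) + h (rshift m i)).
Proof. by rewrite big_split_ord big_split. Qed.

Lemma SNO_LICQ_dual {R : realType} {n m : nat} (F1 F2 : 'I_m -> 'rV[R]_n -> R) x :
    SNO_LICQ F1 F2 x -> (forall i, F1 i x = 0 /\ F2 i x = 0) ->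
  exists W : 'M[R]_(m + m, n), dual_rows (stack F1 F2) x W.
Proof.
move=> licq F0.
pose X := cat_tuple [tuple grad (F1 i) x | i < m] [tuple grad (F2 i) x | i < m].
have [|W dual] := free_dual_family X.
  move: licq; rewrite /SNO_LICQ.
  have allF (F : 'I_m -> 'rV[R]_n -> R) : (forall i, F i x = 0) ->
      [seq i <- enum 'I_m | F i x == 0] = enum 'I_m.
    by move=> Fx; apply/all_filterP/allP => i _; rewrite Fx.
  rewrite allF; last by move=> i; have [] := F0 i.
  by rewrite allF; last by move=> i; have [] := F0 i.
exists W => a b; rewrite -dual -(tnth_nth _ X).
congr (inner_product _ _); case: (split_ordP a) => i ->.
  by rewrite stackl tnth_lshift tnth_mktuple.
by rewrite stackr tnth_rshift tnth_mktuple.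
Qed.

(** A single constraint value moves, so feasibility has to be examined at the
    index [i] only, where it is [cone_escape_direction]. *)
Lemma feasible_escape_direction {R : realType} {n m : nat} (K : cone_type)
    (F1 F2 : 'I_m -> 'rV[R]_n -> R) (x : 'rV[R]_n) (l1 l2 : 'I_m -> R) i :
    feasible_set K F1 F2 x ->
    T_condition K (l1 i) (l2 i) -> saddle_condition K (l1 i) (l2 i) ->
    l1 i <> 0 -> l2 i <> 0 ->
  exists2 b, b = lshift m i \/ b = rshift m i & forall t y, 0 < t ->
    (forall a, stack F1 F2 a y = stack F1 F2 a x - t * (stack l1 l2 b * (a == b)%:R)) ->
    feasible_set K F1 F2 y.
Proof.
move=> Fx Ti Si l1i l2i.
have shiftE b y t : (forall a, stack F1 F2 a y =
      stack F1 F2 a x - t * (stack l1 l2 b * (a == b)%:R)) ->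
    forall j, F1 j y = F1 j x - t * (stack l1 l2 b * (lshift m j == b)%:R) /\
              F2 j y = F2 j x - t * (stack l1 l2 b * (rshift m j == b)%:R).
  move=> Gy j; have := Gy (lshift m j); have := Gy (rshift m j).
  by rewrite !stackl !stackr => -> ->.
case: (cone_escape_direction _ _ _ Ti Si l1i l2i _ (Fx i)) => /= esc.
- exists (lshift m i); first by left.
  move=> t y t0 /shiftE Fy j; have [-> ->] := Fy j.
  rewrite eq_lshift eq_rlshift !mulr0 subr0 stackl.
  by have [->|_] := eqVneq j i; rewrite ?mulr1 ?mulr0 ?subr0; [exact: esc|exact: Fx].
- exists (rshift m i); first by right.
  move=> t y t0 /shiftE Fy j; have [-> ->] := Fy j.
  rewrite eq_rshift eq_lrshift !mulr0 subr0 stackr.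
  by have [->|_] := eqVneq j i; rewrite ?mulr1 ?mulr0 ?subr0; [exact: esc|exact: Fx].
Qed.

Lemma frechet_normal_feasible_set {R : realType} {n m : nat} (K : cone_type)
    (F1 F2 : 'I_m -> 'rV[R]_n -> R) (l1 l2 : 'I_m -> R) (x : 'rV[R]_n) :
    (forall i, differentiable (F1 i) x) -> (forall i, differentiable (F2 i) x) ->
    (forall i, l1 i * F1 i x + l2 i * F2 i x = 0 /\
      \forall a \near (F1 i x, F2 i x), cone K a -> 0 <= l1 i * a.1 + l2 i * a.2) ->
  frechet_normal_cone (feasible_set K F1 F2) x
    (- \sum_a stack l1 l2 a *: grad (stack F1 F2 a) x).
Proof.
move=> dF1 dF2 ray; apply: frechet_normal_of_local_min => [a|].
  by apply: (stackP (fun g => differentiable g x)).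
have /filter_forall ge0 : forall i, \forall y \near x,
    cone K (F1 i y, F2 i y) -> 0 <= l1 i * F1 i y + l2 i * F2 i y.
  move=> i; have [_ h] := ray i.
  have lim : (F1 i y, F2 i y) @[y --> x] --> (F1 i x, F2 i x).
    have c1 : F1 i y @[y --> x] --> F1 i x by exact: differentiable_continuous.
    have c2 : F2 i y @[y --> x] --> F2 i x by exact: differentiable_continuous.
    exact: cvg_pair c1 c2.
  exact: (lim _ h).
apply: filterS ge0 => y h My.
rewrite !sum_stack (eq_bigr (fun=> 0)) => [|i _]; last first.
  by rewrite !stackl !stackr; have [] := ray i.
by rewrite big1// sumr_ge0// => i _; rewrite !stackl !stackr; exact/h/My.
Qed.

Theorem proposition12 (R : realType) (n m : nat) (K : cone_type)
    (f : 'rV[R]_n -> R) (F1 F2 : 'I_m -> 'rV[R]_n -> R) (xbar : 'rV[R]_n)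
    (f_C2 : twice_continuously_differentiable f)
    (F1_C2 : forall i : 'I_m, twice_continuously_differentiable (F1 i))
    (F2_C2 : forall i : 'I_m, twice_continuously_differentiable (F2 i))
    (xbar_feasible : feasible_set K F1 F2 xbar)
    (xbar_LICQ : SNO_LICQ F1 F2 xbar)
    (xbar_biactive : forall i : 'I_m, F1 i xbar = 0 /\ F2 i xbar = 0)
    (xbar_T_stationary : T_stationary K f F1 F2 xbar) :
  ~ N_stationary f (feasible_set K F1 F2) xbar <->
  regular_saddle_point K f F1 F2 xbar.
Proof.
have F1_C1 i := (F1_C2 i).1.
have F2_C1 i := (F2_C2 i).1.
have G_C1 : forall a, continuously_differentiable (stack F1 F2 a).
  exact: stackP.
have [W dual] := SNO_LICQ_dual _ _ _ xbar_LICQ xbar_biactive.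
have act i : i \in biactive F1 F2 xbar.
  by rewrite inE; have [-> ->] := xbar_biactive i; rewrite eqxx.
have sumE l1 l2 : \sum_(i in biactive F1 F2 xbar)
      (l1 i *: grad (F1 i) xbar + l2 i *: grad (F2 i) xbar) =
    \sum_a stack l1 l2 a *: grad (stack F1 F2 a) xbar.
  rewrite sum_stack; apply: eq_big => [i|i _]; first by rewrite act.
  by rewrite !stackl !stackr.
split.
- move=> notN; have [l1 [l2 Tstat]] := xbar_T_stationary.
  have [_ gradE Tcond] := Tstat; rewrite sumE in gradE.
  apply: contrapT => notreg; apply: notN; split => //.
  have nreg i : ~ [/\ saddle_condition K (l1 i) (l2 i), l1 i <> 0 & l2 i <> 0].
    move=> [Si l1i l2i]; apply: notreg; exists l1, l2; split; last by exists i; split.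
    by split => //; exists i.
  have [d ray] := choice (fun i => nonregular_cone_ray _ _ _ (Tcond i (act i)) (nreg i)).
  pose e := \row_a stack (fst \o d) (snd \o d) a.
  have [x [t [xlim t0 Gx]]] := lifted_sequence _ W xbar e G_C1 dual.
  have Fx k i : F1 i (x k) = t k * (d i).1 /\ F2 i (x k) = t k * (d i).2.
    have := Gx k (lshift m i); have := Gx k (rshift m i).
    rewrite !mxE !stackl !stackr/=.
    by have [-> ->] := xbar_biactive i; rewrite !add0r.
  exists (- \sum_a stack l1 l2 a *: grad (stack F1 F2 a) xbar); last by rewrite gradE subrr.
  exists x, (fun k => - \sum_a stack l1 l2 a *: grad (stack F1 F2 a) (x k)).
  split => //.
  + move=> k i; have [-> ->] := Fx k i.
    by have [] := ray i _ (t0 k).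
  + move=> k; apply: frechet_normal_feasible_set => i; [exact: (F1_C1 i).1|exact: (F2_C1 i).1|].
    by have [-> ->] := Fx k i; have [] := ray i _ (t0 k).
  + apply: cvgN; apply: (cvg_big (@add_continuous _)) => a _.
    apply: cvgZ; first exact: cvg_cst.
    exact: (cvg_comp _ _ xlim ((G_C1 a).2 xbar)).
- move=> [l1 [l2 [[[_ gradE Tcond] _] [i [_ Si l1i l2i]]]]].
  move=> [_ [v [x [vs [Mx xlim vN vlim]]] /esym/eqP]].
  rewrite addrC addr_eq0 gradE sumE => /eqP vE; rewrite vE in vlim.
  have blocked b := @blocked_direction _ _ _ (stack F1 F2) W xbar
    (feasible_set K F1 F2) (stack l1 l2) b x vs G_C1 dual xlim vlim vN.
  have nz1 : stack l1 l2 (lshift m i) != 0 by rewrite stackl; exact/eqP.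
  have nz2 : stack l1 l2 (rshift m i) != 0 by rewrite stackr; exact/eqP.
  near \oo => k.
  have [b bi esc] := feasible_escape_direction _ _ _ _ _ _ _ (Mx k) (Tcond i (act i)) Si l1i l2i.
  by case: bi esc => ->; near: k; exact: blocked.
Unshelve. all: by end_near. Qed.
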